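(* Every first-countable $T_0$ space with a countable underlying set is an $\omega$-Rudin space.
   Context: A set is countable if its cardinality is at most $\omega=|\mathbb N|$. For a $T_0$ space $X$, the specialization order is $x\le y$ iff $x\in\overline{\{y\}}$; a subset is saturated if it is an upper set in this order (equivalently, an intersection of open sets). $\mathsf{K}(X)$ is the set of all nonempty compact saturated subsets of $X$. A nonempty set $A\subseteq X$ is irreducible if whenever $A\subseteq F_1\cup F_2$ with $F_1,F_2$ closed, then $A\subseteq F_1$ or $A\subseteq F_2$. For a family $\mathcal K$ of subsets of $X$, let $M(\mathcal K)$ be the set of closed sets $A\subseteq X$ with $A\cap K\ne\emptyset$ for all $K\in\mathcal K$, and let $m(\mathcal K)$ be the set of minimal (under inclusion) members of $M(\mathcal K)$. A family $\mathcal K\subseteq\mathsf K(X)$ is filtered if it is nonempty and for all $K_1,K_2\in\mathcal K$ there is $K_3\in\mathcal K$ with $K_3\subseteq K_1\cap K_2$. A closed set $A$ is an $\omega$-Rudin set if there is a countable filtered family $\mathcal K\subseteq\mathsf K(X)$ with $A\in m(\mathcal K)$. A $T_0$ space $X$ is an $\omega$-Rudin space if every irreducible closed subset of $X$ is an $\omega$-Rudin set. *)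

(* Defs.v *)
From mathcomp Require Import all_boot all_order all_algebra.
From mathcomp Require Import all_classical.
From mathcomp Require Import topology.

Set Implicit Arguments.
Unset Strict Implicit.
Unset Printing Implicit Defensive.

Local Open Scope classical_set_scope.

Definition first_countable (T : topologicalType) :=
  forall x : T, exists B : set (set T),
    [/\ countable B, B `<=` nbhs x
      & forall U, nbhs x U -> exists2 V, B V & V `<=` U].

Definition specialization_le (T : topologicalType) (x y : T) :=
  closure [set y] x.

Definition saturated (T : topologicalType) (A : set T) :=
  forall x y, specialization_le x y -> A x -> A y.

(* The family K(T) *)
Definition compact_saturated (T : topologicalType) : set (set T) :=
  [set K | [/\ K !=set0, compact K & saturated K]].

Definition irreducible_set (T : topologicalType) (A : set T) :=
  A !=set0 /\
  forall F1 F2 : set T, closed F1 -> closed F2 ->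
    A `<=` F1 `|` F2 -> A `<=` F1 \/ A `<=` F2.

(* The family M(KK) *)
Definition closed_meeting (T : topologicalType) (KK : set (set T)) :
    set (set T) :=
  [set A | closed A /\ forall K, KK K -> A `&` K !=set0].

(* The family m(KK) *)
Definition min_closed_meeting (T : topologicalType) (KK : set (set T)) :
    set (set T) :=
  [set A | closed_meeting KK A /\
    forall B, closed_meeting KK B -> B `<=` A -> B = A].

Definition filtered_family (T : Type) (KK : set (set T)) :=
  KK !=set0 /\
  forall K1 K2, KK K1 -> KK K2 -> exists2 K3, KK K3 & K3 `<=` K1 `&` K2.

Definition omega_rudin_set (T : topologicalType) (A : set T) :=
  closed A /\
  exists KK : set (set T),
    [/\ countable KK, KK `<=` @compact_saturated T,
        filtered_family KK & min_closed_meeting KK A].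

Definition omega_rudin_space (T : topologicalType) :=
  kolmogorov_space T /\
  forall A : set T, closed A -> irreducible_set A -> omega_rudin_set A.

(* Main.v *)
Require Import Defs.
From mathcomp Require Import all_boot all_order all_algebra.
From mathcomp Require Import all_classical.
From mathcomp Require Import topology.

(** A countable first-countable space has a countable base. Let [U 0], [U 1],
... enumerate the basic open sets meeting an irreducible closed set [A]. By
irreducibility there is [u n] in [A] lying in [U 0], ..., [U n], so the sequence
[u] converges to every point of [A], in particular to each of its own terms;
hence the upper sets [K n] generated by its tails are compact. A closed subset
of [A] meeting every [K n] contains infinitely many terms of [u], hence all of
their limits, that is, all of [A]. *)

Set Implicit Arguments.
Unset Strict Implicit.
Unset Printing Implicit Defensive.

Local Open Scope classical_set_scope.

Definition up_tail (T : topologicalType) (u : nat -> T) (n : nat) : set T :=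
  [set y | exists2 k, (n <= k)%N & specialization_le (u k) y].

(** Members of a local base are only neighbourhoods, so the base consists of their interiors, a
    countable family because there are countably many points. *)
Lemma first_countable_second_countable (T : topologicalType) :
  first_countable T -> countable [set: T] -> @second_countable T.
Proof.
move=> fc cT; have [B Bx] := choice fc.
exists (\bigcup_(x in [set: T]) (@interior T) @` B x).
  apply: bigcup_countable => // x _; have [cB _ _] := Bx x.
  exact: card_le_trans (card_image_le _ _) cB.
split=> [_ [x _ [V _ <-]]|x U xU]; first exact: open_interior.
have [_ Bsub Bbase] := Bx x; have [V BV VU] := Bbase _ xU.
exists (interior V); last by move=> y /interior_subset /VU.
by split; [exists x => //; exists V|exact: Bsub].
Qed.

Lemma irreducible_bigcap (T : topologicalType) (A : set T) (U : nat -> set T) :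
  irreducible_set A -> (forall i, open (U i)) ->
  (forall i, A `&` U i !=set0) ->
  forall n, exists x, A x /\ forall i, (i < n)%N -> U i x.
Proof.
move=> [[a Aa] irrA] oU AU n.
(* The induction carries an open set [W] rather than a point, since irreducibility compares open
   sets. *)
suff [W [oW WU [x [Ax Wx]]]] : exists W : set T,
    [/\ open W, (forall i, (i < n)%N -> W `<=` U i) & A `&` W !=set0].
  by exists x; split=> // i /WU; apply.
elim: n => [|n [W [oW WU [x [Ax Wx]]]]].
  by exists setT; split=> //; [exact: openT|exists a].
exists (W `&` U n); split; first exact: openI.
  by move=> i; rewrite ltnS leq_eqVlt => /predU1P[-> y []//|/WU WUi y [/WUi]].
(* If [A] missed the intersection, the complements of [W] and [U n] would cover it, so one of them
   would contain [A], yet [A] meets both open sets. *)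
apply: contrapT => AWU0; have [y [Ay Uy]] := AU n.
have [|AW|AUn] := irrA _ _ (open_closedC oW) (open_closedC (oU n)).
- move=> z Az; apply: contrapT => /not_orP[/contrapT Wz /contrapT Uz].
  by apply: AWU0; exists z.
- exact: AW Ax Wx.
- exact: AUn Ay Uy.
Qed.

Lemma irreducible_cvg_seq (T : topologicalType) (A : set T) :
  @second_countable T -> irreducible_set A ->
  exists u : nat -> T, (forall n, A (u n)) /\ forall a, A a -> u @ \oo --> a.
Proof.
move=> [B cB [oB baseB]] irrA; have [[a Aa] _] := irrA.
pose G : set (set T) := [set V | B V /\ A `&` V !=set0].
have GI W b : B W -> A b -> W b -> G W by move=> BW Ab Wb; split=> //; exists b.
have cG : countable G.
  by apply: sub_countable cB; apply: subset_card_le => V [].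
have [G0|[U]] := pfcard_geP cG.
  have [W [BW Wa] _] := baseB a _ filterT.
  by have := GI W a BW Aa Wa; rewrite G0.
have GU n : G (U n) by exact: funS.
have oU n : open (U n) by apply: oB; have [] := GU n.
have AU n : A `&` U n !=set0 by have [] := GU n.
(* The bound [n.+1] puts [u n] in [U n] as well, so [U m] contains [u n] for all [n >= m]. *)
have [u uP] := choice (fun n => irreducible_bigcap irrA oU AU n.+1).
exists u; split=> [n|b Ab V Vb]; first by have [] := uP n.
have [W [BW Wb] WV] := baseB b V Vb.
have /(@surj _ _ _ _ U)[m _ UmW] := GI W b BW Ab Wb.
exists m => // n /= mn; apply: WV; rewrite -UmW.
by have [_] := uP n; apply.
Qed.

Lemma specialization_le_open (T : topologicalType) (x y : T) (V : set T) :
  specialization_le x y -> nbhs x V -> V y.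
Proof. by move=> xy /xy[z [/= ->]]. Qed.

Lemma specialization_le_closed (T : topologicalType) (x y : T) (F : set T) :
  closed F -> specialization_le x y -> F y -> F x.
Proof. by move=> cF xy Fy; apply: cF => V /xy[z [/= -> Vy]]; exists y. Qed.

Lemma specialization_le_refl (T : topologicalType) (x : T) :
  specialization_le x x.
Proof. exact: subset_closure. Qed.

Lemma specialization_le_trans (T : topologicalType) (x y z : T) :
  specialization_le x y -> specialization_le y z -> specialization_le x z.
Proof.
move=> xy yz; apply: (specialization_le_closed _ xy yz).
exact: closed_closure.
Qed.

(** Without a cluster point, the filter is separated from each [u k] in turn and so contains every
    later tail set; but a neighbourhood of the limit [u n] that misses a member of the filter
    contains one of these tail sets. *)
Lemma up_tail_compact (T : topologicalType) (u : nat -> T) (n : nat) :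
  u @ \oo --> u n -> compact (up_tail u n).
Proof.
move=> un F FF Fn; apply: contrapT => noclus.
have sep k : (n <= k)%N ->
    exists S V, [/\ F S, nbhs (u k) V & S `&` V = set0].
  move=> nk; apply: contrapT => nsep; apply: noclus; exists (u k); split.
    by exists k => //; exact: specialization_le_refl.
  move=> S V FS Vk; apply/set0P/eqP => SV; apply: nsep.
  by exists S, V.
have Fup j : F (up_tail u (n + j)).
  elim: j => [|j IH]; first by rewrite addn0.
  have [S [V [FS Vu SV]]] := sep _ (leq_addr j n).
  apply: filterS (filterI IH FS) => y [[k njk uky] Sy].
  (* Here [k] cannot be [n + j]: then [y], lying above [u (n + j)], would be in [V], which is
     disjoint from [S]. *)
  exists k => //; rewrite addnS ltn_neqAle njk andbT.
  apply/eqP => kE; have : (S `&` V) y; last by rewrite SV.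
  by split=> //; apply: specialization_le_open uky _; rewrite -kE.
have [S [V [FS Vu SV]]] := sep _ (leqnn n).
(* Passing to the interior makes [V] a neighbourhood of the late terms, so it also contains all
   points above them. *)
have [N _ NV] := un _ (nbhs_interior Vu).
have /filter_ex[y [[k Nk uky] Sy]] : F (up_tail u (n + N) `&` S).
  exact: filterI.
have : (S `&` V) y; last by rewrite SV.
split=> //; apply: specialization_le_open uky _.
by apply: NV => /=; apply: leq_trans Nk; rewrite leq_addl.
Qed.

Lemma up_tail_mono (T : topologicalType) (u : nat -> T) (m n : nat) :
  (m <= n)%N -> up_tail u n `<=` up_tail u m.
Proof. by move=> mn y [k nk uky]; exists k => //; apply: leq_trans nk. Qed.

Theorem corollary6p9 (T : topologicalType) (T0 : kolmogorov_space T)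
    (fc : first_countable T) (cT : countable [set: T]) :
  omega_rudin_space T.
Proof.
split=> // A clA irrA; split=> //.
have scT : @second_countable T by exact: first_countable_second_countable.
have [u [Au cvgu]] := irreducible_cvg_seq scT irrA.
have un n : up_tail u n (u n) by exists n => //; exact: specialization_le_refl.
exists (range (up_tail u)); split.
- exact: card_le_trans (card_image_le _ _) _.
- move=> _ [n _ <-]; split; first by exists (u n).
  + exact/up_tail_compact/cvgu.
  + move=> x y xy [k nk ukx]; exists k => //.
    exact: specialization_le_trans xy.
- split; first by exists (up_tail u 0); exists 0%N.
  move=> _ _ [m _ <-] [n _ <-]; exists (up_tail u (maxn m n)).
    by exists (maxn m n).
  by move=> y uy; split; apply: up_tail_mono uy; rewrite ?leq_maxl ?leq_maxr.
- split; first by split=> // _ [n _ <-]; exists (u n).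
  move=> C [clC Cmeet] CA; apply/seteqP; split=> // a Aa.
  (* It suffices that [V] meets [C]: a point of [C] in a late tail set lies above some [u k] in [V],
     and [u k] is in [C] because closed sets are lower sets. *)
  apply: (clC) => V Va; have [N _ NV] := cvgu a Aa V Va.
  have [|y [Cy [k Nk uky]]] := Cmeet (up_tail u N); first by exists N.
  by exists (u k); split; [exact: specialization_le_closed clC uky Cy|exact: NV].
Qed.
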